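(* Let $n\ge 2$ and $k\ge1$ be integers. Then \[ \gamma_{[k]R}(C_6\Box P_n)\le \left\lceil\frac{4n}{3}\right\rceil(k+1)+\begin{cases}k+1,& n\equiv 0\pmod 3,\\ 0,& n\equiv 1\pmod 3,\\ k,& n\equiv 2\pmod 3.\end{cases} \]
   Context: For a graph $G$ and $v\in V(G)$, $N(v)$ is the open neighborhood and $N[v]=N(v)\cup\{v\}$. For an integer $k\ge1$, a function $f:V(G)\to\{0,1,\dots,k+1\}$ is a $[k]$-Roman dominating function if for every vertex $v$ with $f(v)<k$ we have $\sum_{u\in N[v]}f(u)\ge k+|\{u\in N(v): f(u)>0\}|$. The weight of $f$ is $\sum_{v}f(v)$, and $\gamma_{[k]R}(G)$ is the minimum weight of a $[k]$-Roman dominating function on $G$. $C_m\Box P_n$ is the Cartesian product of the cycle $C_m$ (vertices $0,\dots,m-1$ mod $m$) and the path $P_n$ (vertices $0,\dots,n-1$): $(i,j)\sim(i',j')$ iff ($i=i'$ and $|j-j'|=1$) or ($j=j'$ and $i'\equiv i\pm1 \pmod m$). *)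

(* Defs.v *)
From mathcomp Require Import all_boot.
Set Implicit Arguments.
Unset Strict Implicit.
Unset Printing Implicit Defensive.

(* A graph is given by its adjacency relation e, meant to be symmetric and
   irreflexive; for the cylinders below see cyl_rel_sym and cyl_rel_irrefl. *)
Section Domination.
Variables (V : finType) (e : rel V).

Definition open_nbhd (v : V) : {set V} := [set u | e v u].
Definition closed_nbhd (v : V) : {set V} := v |: open_nbhd v.

(* Values 0, ..., k+1 are the elements of 'I_k.+2. *)
Definition is_roman (k : nat) (f : {ffun V -> 'I_k.+2}) : bool :=
  [forall v : V, (f v < k) ==>
    (k + #|[set u in open_nbhd v | 0 < f u]| <= \sum_(u in closed_nbhd v) f u)].

Definition weight (k : nat) (f : {ffun V -> 'I_k.+2}) : nat := \sum_(v : V) f v.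

(* The constant function k+1 only serves as a witness that the minimum is
   taken over a nonempty set. *)
Definition roman_number (k : nat) : nat :=
  weight [arg min_(f < [ffun=> ord_max] | @is_roman k f) weight f].

Lemma is_roman_max k : @is_roman k [ffun=> ord_max].
Proof. by apply/forallP=> v; rewrite ffunE /= ltnNge leqnSn. Qed.

Lemma roman_number_min k (f : {ffun V -> 'I_k.+2}) :
  is_roman f -> roman_number k <= weight f.
Proof.
rewrite /roman_number; case: arg_minnP => [|g _ gmin /gmin //].
exact: is_roman_max.
Qed.

Lemma roman_number_attained k :
  exists2 f : {ffun V -> 'I_k.+2}, is_roman f & weight f = roman_number k.
Proof.
rewrite /roman_number; case: arg_minnP => [|g Pg _]; first exact: is_roman_max.
by exists g.
Qed.

End Domination.

(* The cycle C_m; a simple graph for m >= 3. *)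
Definition cycle_rel (m : nat) : rel 'I_m :=
  fun i j => (j == i + 1 %[mod m]) || (j + 1 == i %[mod m]).

Definition path_rel (n : nat) : rel 'I_n :=
  fun i j => (j == i + 1 :> nat) || (i == j + 1 :> nat).

Definition cart_rel (V W : finType) (e : rel V) (e' : rel W) : rel (V * W) :=
  fun x y => ((x.1 == y.1) && e' x.2 y.2) || ((x.2 == y.2) && e x.1 y.1).

Definition cyl_rel (m n : nat) : rel ('I_m * 'I_n) :=
  cart_rel (@cycle_rel m) (@path_rel n).

Lemma cyl_rel_sym m n : symmetric (@cyl_rel m n).
Proof.
move=> [i j] [i' j']; rewrite /cyl_rel /cart_rel /cycle_rel /path_rel /=.
rewrite (eq_sym i' i) (eq_sym j' j) (orbC (nat_of_ord j == _)).
by rewrite (eq_sym (i' %% m)) (eq_sym ((i' + 1) %% m)) (orbC ((i + 1) %% m == _)).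
Qed.

Lemma cyl_rel_irrefl m n : 1 < m -> irreflexive (@cyl_rel m n).
Proof.
move=> m_gt1 [i j]; rewrite /cyl_rel /cart_rel /cycle_rel /path_rel /= !eqxx /=.
rewrite -[X in X == j + 1]addn0 eqn_add2l /= (eq_sym ((i + 1) %% m)) orbb.
by rewrite -[X in X == _ %[mod m]]addn0 eqn_modDl mod0n modn_small.
Qed.

(* Main.v *)
Require Import Defs.
From mathcomp Require Import all_boot all_order all_algebra.
From mathcomp Require Import zify.

(** A set [D] of vertices of value [k + 1] makes every vertex with a neighbour
in [D] satisfy the Roman condition.  Column [j] of the cylinder receives the
set [{0,2}], [{4}], [{1}], [{3,5}], [{1}], [{4}] according to [j] mod 6, that
is, 4 vertices in every 3 columns.  Every column is then dominated by itself
and its two neighbours, and the column 0 does not need a left neighbour.  In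
the last column, which has no right neighbour, nothing is missing if [n] is 1
mod 3, one vertex is missing if [n] is 2 mod 3 (it gets the value [k]), and two
vertices with a common neighbour in the column are missing if [n] is 0 mod 3
(that neighbour gets the value [k + 1]). *)

Set Implicit Arguments.
Unset Strict Implicit.
Unset Printing Implicit Defensive.

(** A neighbour of value [k + 1] accounts for [k] and for its own unit in the count; every other
    positive neighbour pays for its own unit. *)
Lemma is_roman_dominated (V : finType) (e : rel V) k (f : {ffun V -> 'I_k.+2}) :
    irreflexive e ->
    (forall v, f v < k -> exists2 u, e v u & f u = k.+1 :> nat) ->
  is_roman e f.
Proof.
move=> e_irr dom; apply/forallP=> v; apply/implyP=> /dom[u vu fu].
have uN : u \in open_nbhd e v by rewrite inE.
rewrite big_setU1 /=; last by rewrite inE e_irr.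
rewrite -sum1_card (big_setD1 u) ?inE ?vu ?fu //= addnA addn1.
rewrite (big_setD1 u uN) /= fu addnCA leq_add2l.
apply: leq_trans (leq_addl _ _).
rewrite big_mkcond [leqRHS]big_mkcond /=; apply: leq_sum => w _.
by rewrite !inE; case: (w == u); case: (e v w) => //=; case: (val (f w)).
Qed.

Definition pattern (i j : nat) : bool :=
  i \in nth [::] [:: [:: 0; 2]; [:: 4]; [:: 1]; [:: 3; 5]; [:: 1]; [:: 4]]
            (j %% 6).

(** Row [i + 5] is row [i - 1] modulo 6; likewise [j + 5] below stands for the previous column,
    which avoids truncated subtraction. *)
Definition pattern_nbhd (i j : nat) : bool :=
  [|| pattern i j, pattern ((i + 1) %% 6) j | pattern ((i + 5) %% 6) j].

Lemma pattern_mod i j d : pattern i (j + d) = pattern i (j %% 6 + d).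
Proof. by rewrite /pattern modnDml. Qed.

Lemma pattern_pred i j : 0 < j -> pattern i j.-1 = pattern i (j + 5).
Proof. by case: j => // j _; rewrite /pattern addSnnS modnDr. Qed.

(** By periodicity only the residue of [j] modulo 6 matters, which leaves finitely many cases,
    decided by computation. *)
Ltac pattern_cases i j i6 :=
  rewrite /pattern_nbhd -?[in pattern _ j](addn0 j) !(pattern_mod _ j);
  rewrite -?(@modn_dvdm 6 j 3) //;
  move: (j %% 6) (ltn_pmod j (isT : 0 < 6)); clear j;
  do 6?[case: i i6 => [|i] i6 //; try by do 6?[case=> //]].

(** The guard on the last disjunct serves column 0; it bears on the residue to keep the statement
    periodic. *)
Lemma pattern_inner i j : i < 6 ->
  [|| pattern_nbhd i j, pattern i (j + 1) | (j %% 6 != 0) && pattern i (j + 5)].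
Proof. by move=> i6; pattern_cases i j i6. Qed.

(** The common neighbour of the two missing vertices is the single vertex that the pattern has three
    columns further on. *)
Lemma pattern_last0 i j : i < 6 -> j %% 3 = 2 ->
  [|| pattern_nbhd i j, pattern i (j + 5) | pattern_nbhd i (j + 3)].
Proof. by move=> i6; pattern_cases i j i6. Qed.

Lemma pattern_last1 i j : i < 6 -> j %% 3 = 0 ->
  pattern_nbhd i j || pattern i (j + 5).
Proof. by move=> i6; pattern_cases i j i6. Qed.

Lemma pattern_last2 i j : i < 6 -> j %% 3 = 1 ->
  [|| pattern_nbhd i j, pattern i (j + 5) | pattern i (j + 1)].
Proof. by move=> i6; pattern_cases i j i6. Qed.

(** Keeps the extra value in the last column from landing on a vertex that already has value
    [k + 1]. *)
Lemma pattern_disjoint3 i j : j %% 3 = 2 -> ~~ (pattern i j && pattern i (j + 3)).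
Proof.
rewrite -[in pattern _ j](addn0 j) !(pattern_mod _ j) -(@modn_dvdm 6 j 3) //.
move: (j %% 6) (ltn_pmod j (isT : 0 < 6)).
by do 6?[case=> //]; rewrite /pattern /= !inE; case: eqP => // ->.
Qed.

Lemma pattern_disjoint1 i j : j %% 3 = 1 -> ~~ (pattern i j && pattern i (j + 1)).
Proof.
rewrite -[in pattern _ j](addn0 j) !(pattern_mod _ j) -(@modn_dvdm 6 j 3) //.
move: (j %% 6) (ltn_pmod j (isT : 0 < 6)).
by do 6?[case=> //]; rewrite /pattern /= !inE; case: eqP => // ->.
Qed.

Lemma sum_pattern j : \sum_(i < 6) pattern i j = 1 + (j %% 3 == 0).
Proof.
have pattern_mod0 i : pattern i j = pattern i (j %% 6) by rewrite /pattern modn_mod.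
rewrite !big_ord_recr big_ord0 /= !pattern_mod0 -(@modn_dvdm 6 j 3) //.
by move: (j %% 6) (ltn_pmod j (isT : 0 < 6)); do 6?[case=> //].
Qed.

Definition roman_value (n k i j : nat) : nat :=
  pattern i j * k.+1 +
  (j.+1 == n) * ((n %% 3 == 0) * (pattern i (j + 3) * k.+1)
                 + (n %% 3 == 2) * (pattern i (j + 1) * k)).

Lemma roman_value_max n k i j : roman_value n k i j <= k.+1.
Proof.
rewrite /roman_value; case: eqP => [jn|_]; last by case: pattern; lia.
have := @pattern_disjoint3 i j; have := @pattern_disjoint1 i j.
by do 3!case: pattern => //=; lia.
Qed.

Lemma roman_value_pattern n k i j : pattern i j -> roman_value n k i j = k.+1.
Proof.
move=> pij; apply/eqP; rewrite eqn_leq roman_value_max /roman_value pij mul1n.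
exact: leq_addr.
Qed.

Lemma roman_value_last n k i j : j.+1 = n -> n %% 3 = 0 -> pattern i (j + 3) ->
  roman_value n k i j = k.+1.
Proof.
move=> jn n0 pij; apply/eqP; rewrite eqn_leq roman_value_max /roman_value.
by rewrite jn n0 pij !eqxx; lia.
Qed.

Definition roman_fun n k : {ffun 'I_6 * 'I_n -> 'I_k.+2} :=
  [ffun v : 'I_6 * 'I_n => inord (roman_value n k v.1 v.2)].

Lemma roman_funE n k (v : 'I_6 * 'I_n) :
  roman_fun n k v = roman_value n k v.1 v.2 :> nat.
Proof. by rewrite ffunE inordK // ltnS roman_value_max. Qed.

Lemma roman_fun_dominated n k (v : 'I_6 * 'I_n) : 2 <= n -> roman_fun n k v < k ->
  exists2 u, cyl_rel v u & roman_fun n k u = k.+1 :> nat.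
Proof.
case: v => i j n2; rewrite roman_funE /= => fv.
pose full i' j' := roman_value n k i' j' = k.+1.
have side d : d \in [:: 1; 5] -> full ((i + d) %% 6) j ->
    exists2 u, cyl_rel (i, j) u & roman_fun n k u = k.+1 :> nat.
  move=> dP fu; exists (inord ((i + d) %% 6), j).
    rewrite /cyl_rel /cart_rel /cycle_rel /= eqxx inordK ?ltn_pmod //=.
    apply/orP; right; move: dP; rewrite !inE => /orP[] /eqP->.
      by rewrite modn_mod eqxx.
    by rewrite modnDml -addnA modnDr eqxx orbT.
  by rewrite roman_funE /= inordK ?ltn_pmod.
have along j' : j' < n -> (j' == j + 1) || (j == j' + 1 :> nat) ->
    pattern i j' -> exists2 u, cyl_rel (i, j) u & roman_fun n k u = k.+1 :> nat.
  move=> j'n jj' pj'; exists (i, Ordinal j'n).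
    by rewrite /cyl_rel /cart_rel /path_rel /= eqxx jj'.
  by rewrite roman_funE /= roman_value_pattern.
have nfull : ~ full i j by rewrite /full; lia.
(* Here [j'] will be [j] or, for the extra value in the last column, [j + 3]. *)
have nbhd j' : (forall i', pattern i' j' -> full i' j) -> pattern_nbhd i j' ->
    exists2 u, cyl_rel (i, j) u & roman_fun n k u = k.+1 :> nat.
  move=> pf /or3P[/pf //|/pf|/pf]; exact: side.
have here := nbhd j (fun i' => @roman_value_pattern n k i' j).
have left : 0 < j -> pattern i (j + 5) ->
    exists2 u, cyl_rel (i, j) u & roman_fun n k u = k.+1 :> nat.
  by move=> j0; rewrite -pattern_pred //; apply: along; have := ltn_ord j; lia.
have i6 := ltn_ord i; have jn := ltn_ord j.
case: (ltnP j.+1 n) => [j1n|nj1].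
  case/or3P: (pattern_inner j i6) => [//|pj|/andP[j0]].
    by apply: (along _ _ _ pj); lia.
  by apply: left; case: (val j) j0.
have {nj1}jE : j.+1 = n by lia.
(* Since [n >= 2], the last column has a left neighbour. *)
have j0 : 0 < j by lia.
have [n0|[n1|n2']] : n %% 3 = 0 \/ n %% 3 = 1 \/ n %% 3 = 2 by lia.
- case/or3P: (@pattern_last0 i j i6 ltac:(lia)); [exact: here|exact: left|].
  by apply: nbhd => i'; apply: roman_value_last.
- by case/orP: (@pattern_last1 i j i6 ltac:(lia)); [exact: here|exact: left].
- case/or3P: (@pattern_last2 i j i6 ltac:(lia)); [exact: here|exact: left|].
  (* The missing vertex itself has value [k], against [fv]. *)
  by move=> pj; move: fv; rewrite /roman_value jE eqxx n2' pj; lia.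
Qed.

Lemma sum_roman_value n k j : \sum_(i < 6) roman_value n k i j =
  (1 + (j %% 3 == 0)) * k.+1 +
  (j.+1 == n) * ((n %% 3 == 0) * k.+1 + (n %% 3 == 2) * k).
Proof.
rewrite big_split -big_distrl -big_distrr big_split -!big_distrr -!big_distrl /=.
rewrite !sum_pattern; case: (j.+1 =P n) => [jn|_] //.
(* In both cases the shifted column has index 2 modulo 3, so it holds one pattern vertex. *)
have -> : (n %% 3 == 0) * ((1 + ((j + 3) %% 3 == 0)) * k.+1) = (n %% 3 == 0) * k.+1.
  by case: (n %% 3 =P 0) => // n0; rewrite (_ : _ == 0 = false) ?mul1n //; lia.
have -> // : (n %% 3 == 2) * ((1 + ((j + 1) %% 3 == 0)) * k) = (n %% 3 == 2) * k.
by case: (n %% 3 =P 2) => // n2; rewrite (_ : _ == 0 = false) ?mul1n //; lia.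
Qed.

(** The columns with two vertices are the multiples of 3, and [(n + 2) %/ 3] is [n / 3] rounded
    up. *)
Lemma sum_column_sizes n : \sum_(j < n) (1 + (j %% 3 == 0)) = n + (n + 2) %/ 3.
Proof.
elim: n => [|n IHn]; first by rewrite big_ord0.
by rewrite big_ord_recr /= IHn; lia.
Qed.

Lemma weight_roman_fun n k : 0 < n -> weight (roman_fun n k) =
  (n + (n + 2) %/ 3) * k.+1 + ((n %% 3 == 0) * k.+1 + (n %% 3 == 2) * k).
Proof.
case: n => // n _; rewrite /weight.
under eq_bigr do rewrite roman_funE.
rewrite -(pair_bigA _ (fun i j : 'I__ => roman_value n.+1 k i j)) exchange_big /=.
under eq_bigr do rewrite sum_roman_value.
rewrite big_split -!big_distrl /= sum_column_sizes big_ord_recr /= eqxx big1 //.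
  by rewrite mul1n.
by move=> j _; have := ltn_ord j; case: eqP => //; lia.
Qed.

Lemma ceil_four_thirds n :
  ((n + (n + 2) %/ 3)%:Z <= Num.ceil ((4 * n)%:R / 3%:R : rat))%R.
Proof.
have := Num.Theory.ceil_ge ((4 * n)%:R / 3%:R : rat)%R.
set c := Num.ceil _.
(* Clearing the denominator leaves the integer inequality [4 * n <= c * 3]. *)
rewrite Num.Theory.ler_pdivrMr // !ssrint.pmulrn.
rewrite -ssrint.intrM ssrint.ler_int; lia.
Qed.

Theorem theorem9 (n k : nat) (hn : 2 <= n) (hk : 1 <= k) :
  ((roman_number (@cyl_rel 6 n) k)%:Z <=
    Num.ceil ((4 * n)%:R / 3%:R : rat) * (k + 1)%:Z +
    (if n == 0 %[mod 3] then k + 1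
     else if n == 1 %[mod 3] then 0 else k)%N%:Z)%R.
Proof.
have roman_f : is_roman (@cyl_rel 6 n) (roman_fun n k).
  apply: is_roman_dominated => [|v]; first exact: cyl_rel_irrefl.
  exact: roman_fun_dominated.
have := roman_number_min roman_f; rewrite weight_roman_fun; last exact: ltnW.
have := ceil_four_thirds n.
set c := Num.ceil _; set r := roman_number _ _; set a := (n + _)%N => ac.
have ack : (a%:Z * (k + 1)%:Z <= c * (k + 1)%:Z)%R.
  by rewrite Num.Theory.ler_wpM2r.
have -> : (n == 0 %[mod 3]) = (n %% 3 == 0) by lia.
have -> : (n == 1 %[mod 3]) = (n %% 3 == 1) by lia.
set t := ((n %% 3 == 0) * k.+1 + (n %% 3 == 2) * k).
have <- : t = if n %% 3 == 0 then (k + 1)%N else if n %% 3 == 1 then 0 else k.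
  have : n %% 3 < 3 by rewrite ltn_mod.
  by rewrite /t; move: (n %% 3) => [|[|[|]]] //= _; lia.
lia.
Qed.
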